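(* For all integers $t\geq 1$ and $r\geq 3$ there exists a number $f(t,r)$ such that every $(6t-4)$-edge-connected graph $G$ with $|V(G)|\geq f(t,r)$ contains $C_{t,r}$ as an immersion.
   Context: All graphs are finite and loopless but may have parallel edges. Lifting a pair of adjacent edges $uv,vw$ means deleting them and adding a new edge $uw$ (parallel to any existing $uw$ edges; if $u=w$ the resulting loop is deleted). A graph $H$ is an immersion of $G$ ($G$ contains $H$ as an immersion) if a graph isomorphic to $H$ can be obtained from a subgraph of $G$ by repeatedly lifting pairs of edges; equivalently, there is an injective map from $V(H)$ into $V(G)$ and an assignment to each edge of $H$ of a path in $G$ joining the images of its ends, such that these paths are pairwise edge-disjoint. The images of the vertices of $H$ are called the terminals of the immersion. For integers $t\geq 1$, $r\geq 2$, $C_{t,r}$ denotes the graph obtained from a cycle on $r$ vertices by replacing each edge by $t$ parallel edges. *)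

(* Defs.v *)
From mathcomp Require Import all_boot.
Set Implicit Arguments. Unset Strict Implicit. Unset Printing Implicit Defensive.

Section Multigraph.
Variables (V E : finType) (ends : E -> V * V).

Definition loopless : Prop := forall e : E, (ends e).1 != (ends e).2.

Definition joins (e : E) (x y : V) : bool :=
  (ends e == (x, y)) || (ends e == (y, x)).

Fixpoint walk (x y : V) (es : seq E) : Prop :=
  match es with
  | [::] => x = y
  | e :: es' => exists z : V, joins e x z /\ walk z y es'
  end.

Definition adj_minus (X : {set E}) : rel V :=
  fun x y => [exists e, (e \notin X) && joins e x y].

Definition edge_connected (k : nat) : Prop :=
  forall X : {set E}, #|X| < k -> forall u v : V, connect (adj_minus X) u v.

End Multigraph.

(* H (with ends endsH) is an immersion of G (with ends endsG): an injective
   map phi : V(H) -> V(G) and, for each edge of H, a walk in G joining the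
   images of its ends, such that all these edge sequences are pairwise
   edge-disjoint and each uses no edge twice (i.e. their concatenation is
   duplicate-free). *)
Definition immersion (VH EH : finType) (endsH : EH -> VH * VH)
  (VG EG : finType) (endsG : EG -> VG * VG) : Prop :=
  exists phi : VH -> VG, injective phi /\
  exists P : EH -> seq EG,
    (forall h : EH, walk endsG (phi (endsH h).1) (phi (endsH h).2) (P h)) /\
    uniq (flatten [seq P h | h <- enum EH]).

(* C_{t,r}: cycle on vertices 'I_r, each edge i -- i+1 (mod r) replaced by
   t parallel edges, indexed by (i, j) : 'I_r * 'I_t. *)
Definition C_ends (t r : nat) (p : 'I_r * 'I_t) : 'I_r * 'I_r :=
  (p.1, ordS p.1).

(* Main.v *)
Require Import Defs.
From mathcomp Require Import all_boot zify.

Set Implicit Arguments.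
Unset Strict Implicit.
Unset Printing Implicit Defensive.

(** For [t >= 2] we have [6t - 4 >= 4t], so the edges can be coloured with [2t]
    colours such that every colour class is connected and spanning.  The classes
    come in [t] pairs; in each pair, adding to the first class a suitable set of
    edges of the second makes all degrees even, which gives [t] edge-disjoint
    closed trails, each visiting every vertex.  By Erdos-Szekeres, [r] vertices
    are met in the same cyclic order, up to reversal, by all of them; cutting the
    trails at these vertices yields the immersion.

    For [t = 1] one closed trail with many vertices suffices.  If some vertex has
    many neighbours, a longest closed trail through it is such a trail; otherwise
    some two vertices are far apart, and they lie on a common closed trail.

    The colouring maximises the number of triples (colour, u, v) such that u and
    v are joined in that colour.  An edge on a cycle of its class can be
    recoloured at will, which by maximality changes no class connectivity; the
    edges that become recolourable in this way span subgraphs connected in every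
    colour, and all the other edges are bridges of their classes, too few to
    meet the edge-connectivity bound on the boundaries of these subgraphs. *)

(** * Connectivity, walks and trails in a multigraph *)

Lemma connect_crossing (T : finType) (e : rel T) (P : pred T) x y :
  connect e x y -> P x -> ~~ P y -> exists u v, [/\ e u v, P u & ~~ P v].
Proof.
case/connectP=> p; elim: p x => [|z p IHp] x /=; first by move=> _ -> ->.
case/andP=> exz pz ey Px nPy; have [Pz|nPz] := boolP (P z); last by exists x, z.
exact: IHp pz ey Pz nPy.
Qed.

Section Graph.
Variables (V E : finType) (ends : E -> V * V).
Local Notation walk := (walk ends).
Local Notation joins := (joins ends).
Implicit Types (A B D : {set E}) (x y z w : V) (es : seq E).

Definition adj A : rel V := fun x y => [exists e in A, joins e x y].
Definition con A : rel V := connect (adj A).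

Lemma joinsC e x y : joins e x y = joins e y x.
Proof. by rewrite /Defs.joins orbC. Qed.

Lemma joins_ends e : joins e (ends e).1 (ends e).2.
Proof. by rewrite /Defs.joins -surjective_pairing eqxx. Qed.

Lemma joinsP e x y :
  joins e x y -> (ends e).1 = x /\ (ends e).2 = y \/ (ends e).1 = y /\ (ends e).2 = x.
Proof. by case/orP=> /eqP ->; [left|right]. Qed.

Lemma joins_fun e x y z : joins e x y -> joins e x z -> y = z.
Proof. by move=> /joinsP[[a b]|[a b]] /joinsP[[c d]|[c d]]; congruence. Qed.

Lemma adj_sym A : symmetric (adj A).
Proof. by move=> x y; apply: eq_existsb => e; rewrite joinsC. Qed.

Lemma con_sym A x y : con A x y = con A y x.
Proof. exact: sym_connect_sym (@adj_sym A) _ _. Qed.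

Lemma con_trans A y x z : con A x y -> con A y z -> con A x z.
Proof. exact: connect_trans. Qed.

Lemma con_refl A x : con A x x.
Proof. exact: connect0. Qed.

Lemma con1 A e x y : e \in A -> joins e x y -> con A x y.
Proof. by move=> eA jxy; apply/connect1/existsP; exists e; rewrite eA. Qed.

Lemma con_endsE A e x y : joins e x y -> con A (ends e).1 (ends e).2 = con A x y.
Proof. by case/joinsP=> [] [-> ->] //; rewrite con_sym. Qed.

Lemma con_sub A B :
  (forall e, e \in A -> con B (ends e).1 (ends e).2) -> subrel (con A) (con B).
Proof.
move=> AB; apply: connect_sub => x y /existsP[e /andP[eA jxy]].
by rewrite -[connect _ _ _](con_endsE B jxy) AB.
Qed.

Lemma con_mono A B : A \subset B -> subrel (con A) (con B).
Proof. by move/subsetP=> AB; apply: con_sub => e /AB eB; apply: con1 eB (joins_ends e). Qed.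

Lemma con_crossing A (P : pred V) x y :
  con A x y -> P x -> ~~ P y -> exists e u v, [/\ e \in A, joins e u v, P u & ~~ P v].
Proof.
move=> cxy Px Py; have [u [v [/existsP[e /andP[eA j]] Pu Pv]]] := connect_crossing cxy Px Py.
by exists e, u, v.
Qed.

Lemma walk_cat x y a b : walk x y (a ++ b) <-> exists2 z, walk x z a & walk z y b.
Proof.
elim: a x => [|e a IHa] x /=.
  by split=> [|[z ->]] //; exists x.
split=> [[u [j /IHa[z wa wb]]]|[z [u [j wa]] wb]]; first by exists z => //; exists u.
by exists u; split=> //; apply/IHa; exists z.
Qed.

Lemma walk1 e x y : joins e x y -> walk x y [:: e].
Proof. by exists y. Qed.

Lemma walk_rev x y a : walk x y a -> walk y x (rev a).
Proof.
elim: a x => [|e a IHa] x /=; first by move=> ->.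
case=> u [j /IHa wa]; rewrite rev_cons -cats1; apply/walk_cat; exists u => //.
by apply: walk1; rewrite joinsC.
Qed.

Lemma walk_fun x y z a : walk x y a -> walk x z a -> y = z.
Proof.
elim: a x => [|e a IHa] x /=; first by move=> <- <-.
by move=> [u [ju wu]] [u' [ju' wu']]; move: wu'; rewrite -(joins_fun ju ju'); apply: IHa.
Qed.

Lemma walk_con A x y a : walk x y a -> {subset a <= A} -> con A x y.
Proof.
elim: a x => [|e a IHa] x /=; first by move=> -> _; apply: con_refl.
case=> u [j wa] aA; apply: con_trans (con1 _ j) (IHa _ wa _); first by rewrite aA ?mem_head.
by move=> f fa; rewrite aA // inE fa orbT.
Qed.

(** If the first edge [e] recurs in the trail [b] found for the rest, cut there: either the
    recurrence also leaves [x], and [e :: b2] works, or it arrives at [x], and [b2] does. *)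
Lemma walk_uniq x y a :
  walk x y a -> exists b, [/\ walk x y b, uniq b & {subset b <= a}].
Proof.
elim: a x => [|e a IHa] x /=; first by exists [::].
case=> u [j /IHa[b [wb ub ba]]]; have sub c : {subset c <= b} -> {subset c <= e :: a}.
  by move=> cb f /cb/ba fa; rewrite inE fa orbT.
have [eb|neb] := boolP (e \in b); last first.
  exists (e :: b); split=> /=; [by exists u|by rewrite neb|].
  by move=> f; rewrite !inE => /predU1P[->|/ba->]; rewrite ?eqxx ?orbT.
case/splitPr: eb wb ub sub => b1 b2 /walk_cat[z w1 [z' [jz w2]]].
rewrite cat_uniq => /and3P[_ _ /= ub2] sub.
have [zx|z'x] : z = x \/ z' = x.
  by move: (joinsP j) (joinsP jz) => [[-> ->]|[-> ->]] [[]|[]]; auto.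
  - exists (e :: b2); split=> //; first by exists z'; rewrite -zx.
    by apply: sub => f fb; rewrite mem_cat fb orbT.
  - exists b2; split; [by rewrite -z'x| by case/andP: ub2|].
    by apply: sub => f fb; rewrite mem_cat inE fb !orbT.
Qed.

Lemma con_trail A x y :
  con A x y -> exists es, [/\ walk x y es, uniq es & {subset es <= A}].
Proof.
move=> cxy; suff [es wes sA] : exists2 es, walk x y es & {subset es <= A}.
  by have [b [? ? ba]] := walk_uniq wes; exists b; split=> // f /ba/sA.
have [p] := connectP cxy; elim: p x {cxy} => [|z p IHp] x /=; first by move=> _ ->; exists [::].
case/andP=> /existsP[e /andP[eA j]] pz ey; have [es wes sA] := IHp _ pz ey.
exists (e :: es); first by exists z.
by move=> f; rewrite inE => /predU1P[->|/sA].
Qed.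

Definition meets es x := has (fun e => ((ends e).1 == x) || ((ends e).2 == x)) es.
(** The start [w] counts as visited even when [es] is empty, so inductions can begin with the empty
    trail. *)
Definition visits w es x := (x == w) || meets es x.

Lemma meets_cat a b x : meets (a ++ b) x = meets a x || meets b x.
Proof. exact: has_cat. Qed.

Lemma meets_joins e es x y : e \in es -> joins e x y -> meets es x /\ meets es y.
Proof.
by move=> ees /joinsP[[e1 e2]|[e1 e2]]; split; apply/hasP; exists e => //; rewrite e1 e2 eqxx ?orbT.
Qed.

Lemma visits_split w w' es x : walk w w' es -> visits w es x ->
  exists a b, [/\ es = a ++ b, walk w x a & walk x w' b].
Proof.
rewrite /visits; have [->|] := eqVneq x w; first by exists [::], es.
move=> /= xw; elim: es w xw => [|e es IHes] w xw //= [u [j wu]] mx.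
have [ux|ux] := eqVneq x u.
  by exists [:: e], es; rewrite ux; split=> //; apply: walk1.
have mx' : meets es x.
  case/orP: mx => //; rewrite ![_ == x]eq_sym.
  by case/joinsP: j => [] [-> ->]; rewrite (negPf xw) (negPf ux).
have [a [b [-> wa wb]]] := IHes u ux wu mx'.
by exists (e :: a), b; split=> //; exists u.
Qed.

Lemma visits_end w w' es : walk w w' es -> visits w es w'.
Proof.
elim: es w => [|e es IHes] w /=; first by move=> ->; rewrite /visits eqxx.
case=> u [j /IHes]; rewrite /visits; case/orP=> [/eqP ->|m]; last by rewrite /= [X in _ || (_ || X)]m !orbT.
by rewrite (proj2 (meets_joins (mem_head e es) j)) orbT.
Qed.

Lemma visits_cat w a b x y : walk w x a -> visits w (a ++ b) y = visits w a y || visits x b y.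
Proof.
move=> wa; rewrite /visits meets_cat orbA; have [->|//] := eqVneq y x.
by have:= visits_end wa; rewrite /visits => ->; rewrite ?orbT.
Qed.

Definition closed_trail w es := walk w w es /\ uniq es.

End Graph.

(** * Packing connected spanning subgraphs *)

Section Packing.
Variables (V E : finType) (ends : E -> V * V).
Local Notation walk := (walk ends).
Local Notation joins := (joins ends).
Local Notation con := (con ends).
Implicit Types (A B D : {set E}) (x y z w : V) (es : seq E).

Lemma edge_connected_con k (X : {set E}) x y : edge_connected ends k -> #|X| < k -> con (~: X) x y.
Proof.
move=> ec /ec/(_ x y); rewrite /con; congr is_true.
by apply: eq_connect => u v; apply: eq_existsb => e; rewrite inE.
Qed.

Definition cut (S : {set V}) := [set e | ((ends e).1 \in S) (+) ((ends e).2 \in S)].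

Lemma joins_cut (S : {set V}) e x y : joins e x y -> (e \in cut S) = (x \in S) (+) (y \in S).
Proof. by rewrite inE => /joinsP[] [-> ->] //; rewrite addbC. Qed.

Lemma edge_connected_cut k (S : {set V}) x y :
  edge_connected ends k -> x \in S -> y \notin S -> k <= #|cut S|.
Proof.
move=> ec xS yS; rewrite leqNgt; apply/negP => /(edge_connected_con x y ec) c.
have [e [u [v [eC j uS vS]]]] := con_crossing c xS yS.
by move: eC; rewrite in_setC (joins_cut _ j) (uS : u \in S) (negPf (vS : v \notin S)).
Qed.

Definition component A x : {set V} := [set y | con A x y].
Definition components A : {set {set V}} := [set component A x | x in V].

Lemma eq_component A x y : (component A x == component A y) = con A x y.
Proof.
apply/eqP/idP => [/setP/(_ y)|cxy]; first by rewrite !inE con_refl.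
apply/setP => z; rewrite !inE; apply/idP/idP; apply: con_trans => //.
by rewrite con_sym.
Qed.

Lemma card_components_gt0 A x : 0 < #|components A|.
Proof. by apply/card_gt0P; exists (component A x); apply: imset_f. Qed.

(** Restoring [e] maps the components onto the new ones; were this map injective, the ends of [e],
    having the same image, would be joined without [e]. *)
Lemma card_components_bridge A e : ~~ con (A :\ e) (ends e).1 (ends e).2 -> e \in A ->
  #|components A| < #|components (A :\ e)|.
Proof.
move=> br eA; pose h (C : {set V}) := [set y | [exists x in C, con A x y]].
have hC x : h (component (A :\ e) x) = component A x.
  apply/setP => y; rewrite !inE; apply/existsP/idP => [[z]|cxy].
    by rewrite inE => /andP[/(con_mono (subsetDl _ _)) xz]; apply: con_trans.
  by exists x; rewrite inE con_refl.
have -> : components A = h @: components (A :\ e).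
  rewrite /components -imset_comp; apply: eq_imset => x /=; by rewrite hC.
rewrite ltn_neqAle leq_imset_card andbT; apply: contra br => /imset_injP inj.
rewrite -eq_component; apply/eqP/inj; rewrite ?imset_f // !hC; apply/eqP.
by rewrite eq_component (con1 eA) // joins_ends.
Qed.

(** Each deleted edge adds a component, and the edges still to be deleted remain bridges. *)
Lemma card_bridges A (S : {set E}) : A \subset S ->
  (forall e, e \in S :\: A -> ~~ con (S :\ e) (ends e).1 (ends e).2) ->
  #|S :\: A| + #|components S| <= #|components A|.
Proof.
elim: {S}_.+1 {-2}S (ltnSn #|S :\: A|) => // n IHn S ltS sAS br.
have [SA0|[e eSA]] := set_0Vmem (S :\: A).
  have -> : S = A by apply/eqP; rewrite eqEsubset sAS -setD_eq0 SA0 eqxx.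
  by rewrite setDv cards0.
have /setDP[eS eA] := eSA.
have SDe : (S :\ e) :\: A = (S :\: A) :\ e by rewrite setDDl setUC -setDDl.
have cS := cardsD1 e (S :\: A); rewrite eSA in cS.
have lt := card_components_bridge (br e eSA) eS.
have := IHn (S :\ e); rewrite SDe => IH.
suff : #|(S :\: A) :\ e| + #|components (S :\ e)| <= #|components A| by lia.
apply: IH; first lia.
  by rewrite subsetD1 sAS.
move=> f /setD1P[_ fSA]; apply: contra (br f fSA); apply: con_mono.
by apply: setSD; apply: subsetDl.
Qed.

(** * Maximal colourings and free edges *)

Section Colouring.
Variable K : finType.
Implicit Types (c : {ffun E -> K}) (j : K).

Definition cls c j := [set e | c e == j].
Definition connected_pairs c : {set K * V * V} := [set q | con (cls c q.1.1) q.1.2 q.2].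
Definition free c e := con (cls c (c e) :\ e) (ends e).1 (ends e).2.
Definition recolour c e j : {ffun E -> K} := [ffun f => if f == e then j else c f].
Definition recolour_step : rel {ffun E -> K} :=
  fun c c' => [exists e, exists j, free c e && (c' == recolour c e j)].

Lemma mem_recolour c e j : e \in cls (recolour c e j) j.
Proof. by rewrite inE ffunE eqxx. Qed.

Lemma sub_recolour c e j k : cls c k :\ e \subset cls (recolour c e j) k.
Proof. by apply/subsetP => f; rewrite !inE ffunE => /andP[/negPf->]. Qed.

(** A path using [e] in its old class is rerouted along the rest of a cycle through [e]. *)
Lemma recolour_connected c e j : free c e ->
  connected_pairs c \subset connected_pairs (recolour c e j).
Proof.
move=> fr; apply/subsetP => -[[k x] y]; rewrite !inE /=; apply: con_sub => f fk.
have [ef|nfe] := eqVneq f e; last first.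
  by apply: con1 (joins_ends _ _); move: fk; rewrite !inE ffunE (negPf nfe).
move: fk; rewrite ef inE => /eqP ck; apply: con_mono (sub_recolour _ _ _ _) _ _ _.
by rewrite -ck.
Qed.

Variable c0 : {ffun E -> K}.
Hypothesis c0_max : forall c, #|connected_pairs c| <= #|connected_pairs c0|.

Definition reach := connect recolour_step c0.
Definition free_edges := [set e | [exists c, reach c && free c e]].
Local Notation E0 := free_edges.

Lemma reach_step c e j : reach c -> free c e -> reach (recolour c e j).
Proof.
move=> rc fr; apply: connect_trans rc (connect1 _); apply/existsP; exists e.
by apply/existsP; exists j; rewrite fr eqxx.
Qed.

Lemma reach_ind (P : {ffun E -> K} -> Prop) : P c0 ->
  (forall c e j, reach c -> free c e -> P c -> P (recolour c e j)) -> forall c, reach c -> P c.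
Proof.
move=> P0 Pstep c /connectP[p pp ->] {c}.
elim/last_ind: p pp => [|p c IHp] //; rewrite rcons_path last_rcons => /andP[pp].
case/existsP=> e /existsP[j /andP[fr /eqP ->]]; apply: Pstep => //; last exact: IHp.
by apply/connectP; exists p.
Qed.

(** Recolouring a free edge loses no pair, and maximality of [c0] excludes a gain. *)
Lemma reach_connected c : reach c -> connected_pairs c = connected_pairs c0.
Proof.
move: c; apply: reach_ind => // c e j rc fr IH; apply/esym/eqP.
by rewrite eqEcard -{1}IH recolour_connected //=.
Qed.

(* Recolouring a free edge to [j] cannot create new connected pairs, so its
   ends were already joined in every class. *)
Lemma free_con c e j : reach c -> free c e -> con (cls c j) (ends e).1 (ends e).2.
Proof.
move=> rc fr; have:= reach_connected (reach_step j rc fr).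
rewrite -(reach_connected rc) => /setP/(_ (j, (ends e).1, (ends e).2)).
by rewrite !inE /= => <-; apply: con1 (joins_ends _ _); apply: mem_recolour.
Qed.

(* After recolouring [e] to [j], all edges of a [j]-path joining its ends lie
   on a [j]-cycle, so they are free as well. *)
Lemma free_con_free c e j : reach c -> free c e ->
  con (cls c j :&: E0) (ends e).1 (ends e).2.
Proof.
move=> rc fr; pose c' := recolour c e j.
have rc' : reach c' by apply: reach_step.
have ej : e \in cls c' j by apply: mem_recolour.
have : con (cls c j :\ e) (ends e).1 (ends e).2.
  have [ce|nce] := eqVneq (c e) j; first by rewrite -ce.
  have -> : cls c j :\ e = cls c j; last exact: free_con.
  by apply/setDidPl; rewrite disjoint_sym disjoints1 inE.
case/con_trail=> es [wes ues sub].
apply: walk_con (wes) _ => f fes; have:= sub _ fes; rewrite !inE => /andP[nfe /eqP cf].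
rewrite cf eqxx /=; apply/existsP; exists c'; rewrite rc' /free.
have -> : c' f = j by rewrite ffunE (negPf nfe).
case/splitPr: fes wes ues sub => a b /walk_cat[u wa [v [jf wb]]].
rewrite cat_uniq /= => /and3P[_ /norP[fa _] /andP[fb _]] sub.
have [sa sb] : {subset a <= cls c' j :\ f} /\ {subset b <= cls c' j :\ f}.
  split=> g gab; have := sub g; rewrite mem_cat inE gab ?orbT => /(_ isT) gc;
  rewrite in_setD1 (subsetP (sub_recolour _ _ _ _) _ gc) andbT;
  by apply: contraTneq gab => ->.
rewrite (con_endsE _ jf); apply: con_trans (_ : con _ u (ends e).1) _.
  by rewrite con_sym; apply: walk_con wa sa.
apply: con_trans (_ : con _ (ends e).2 v); last by rewrite con_sym; apply: walk_con wb sb.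
by apply: con1 (joins_ends _ _); rewrite in_setD1 ej eq_sym nfe.
Qed.

(** The only edge that a step can add to class [j] is [e], whose ends were already joined there by
    free edges. *)
Lemma reach_con_free c j : reach c -> subrel (con (cls c j :&: E0)) (con (cls c0 j :&: E0)).
Proof.
move: c; apply: reach_ind => // c e k rc fr IH x y cxy; apply: IH.
apply: con_sub cxy => f; rewrite inE => /andP[fk fE].
have [->|nfe] := eqVneq f e; first exact: free_con_free.
apply: con1 (joins_ends _ _); rewrite inE fE andbT.
by move: fk; rewrite !inE ffunE (negPf nfe).
Qed.

(** A free edge is free in some reachable colouring; there free edges of colour [j] join its ends,
    and this connection pulls back to [c0]. *)
Lemma con_free_edges j : con E0 =2 con (cls c0 j :&: E0).
Proof.
move=> x y; apply/idP/idP; last by apply: con_mono; apply: subsetIr.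
apply: con_sub => e; rewrite inE => /existsP[c /andP[rc fr]].
exact: reach_con_free rc _ _ (free_con_free j rc fr).
Qed.

Lemma card_components_free_edges j : #|components (cls c0 j :&: E0)| = #|components E0|.
Proof.
congr #|pred_of_set _|; apply: eq_imset => x; apply/setP => y.
by rewrite !inE -con_free_edges.
Qed.

(** The non-free edges of a class are bridges of it, so they are fewer than the components of the
    free edges; sum over the colours. *)
Lemma card_nonfree : V -> #|~: E0| + #|K| <= #|K| * #|components E0|.
Proof.
move=> x0.
have le j : #|cls c0 j :\: E0| + 1 <= #|components E0|.
  rewrite -(card_components_free_edges j).
  apply: leq_trans (card_bridges (S := cls c0 j) (subsetIl _ _) _).
    rewrite setDIr setDv set0U leq_add2l; exact: card_components_gt0 x0.
  move=> e; rewrite setDIr setDv set0U => /setDP[ej eE].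
  apply: contra eE => fr; rewrite inE; apply/existsP; exists c0; rewrite /reach connect0.
  by move: ej; rewrite inE /free => /eqP ->.
have -> : #|~: E0| = \sum_j #|cls c0 j :\: E0|.
  rewrite -sum1_card (partition_big c0 predT) //=; apply: eq_bigr => j _.
  rewrite -sum1_card; apply: eq_bigl => e; by rewrite !inE andbC.
rewrite -[X in _ + X]sum1_card -big_split /= -sum_nat_const.
exact: leq_sum.
Qed.

(** Edges leaving a component are non-free, and each lies in at most two of the cuts, those of the
    components of its ends. *)
Lemma card_cut_sum : \sum_(C in components E0) #|cut C| <= 2 * #|~: E0|.
Proof.
have cutE C : C \in components E0 -> cut C \subset ~: E0.
  case/imsetP=> x _ ->; apply/subsetP => e; rewrite !inE; apply: contraL => /existsP[c cf].
  have ceE : con E0 (ends e).1 (ends e).2.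
    by apply: con1 (joins_ends _ _); rewrite inE; apply/existsP; exists c.
  have -> : con E0 x (ends e).1 = con E0 x (ends e).2.
    by apply/idP/idP => h; apply: con_trans h _; rewrite // con_sym.
  by rewrite addbb.
have -> : \sum_(C in components E0) #|cut C| = \sum_(C in components E0) \sum_(e in ~: E0) (e \in cut C).
  apply: eq_bigr => C /cutE sub; rewrite -sum1_card big_mkcond [RHS]big_mkcond /=.
  by apply: eq_bigr => e _; case: ifP => [/(subsetP sub)->|_] //; rewrite if_same.
rewrite exchange_big /= mulnC -sum_nat_const; apply: leq_sum => e _.
apply: leq_trans (_ : #|[set component E0 (ends e).1; component E0 (ends e).2]| <= _); last first.
  by rewrite cards2; case: eqP.
rewrite -big_mkcondr /= sum1_card; apply/subset_leq_card/subsetP => C.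
rewrite !inE => /andP[/imsetP[x _ ->]]; rewrite !inE !eq_component => eC.
by case: (con E0 x (ends e).1) eC.
Qed.

(** With [m > 1] components, the cuts force at least [#|K| * m] non-free edges, while [card_nonfree]
    allows [#|K| * (m - 1)]. *)
Lemma free_edges_span x y : 0 < #|K| -> edge_connected ends (2 * #|K|) -> con E0 x y.
Proof.
move=> K0 ec; apply/negPn/negP => ncxy.
have le : #|components E0| * (2 * #|K|) <= 2 * #|~: E0|.
  apply: leq_trans card_cut_sum; rewrite -sum_nat_const; apply: leq_sum => C /imsetP[u _ ->].
  have [v uv] : exists v, ~~ con E0 u v.
    have [cux|] := boolP (con E0 u x); last by exists x.
    exists y; apply: contra ncxy; apply: con_trans; by rewrite con_sym.
  by apply: (@edge_connected_cut _ _ u v) ec _ _; rewrite inE ?con_refl.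
have := card_nonfree x; lia.
Qed.

End Colouring.

(** This is the well-known corollary of the Nash-Williams-Tutte theorem, with connected classes in
    place of spanning trees. *)
Lemma packing (K : finType) : 0 < #|K| -> edge_connected ends (2 * #|K|) ->
  exists c : {ffun E -> K}, forall j x y, con (cls c j) x y.
Proof.
move=> K0 ec; have /card_gt0P[j0 _] := K0.
have [c0 _ c0_max] := @arg_maxnP _ [ffun=> j0] xpredT (fun c : {ffun E -> K} => #|connected_pairs c|) isT.
exists c0 => j x y; have := free_edges_span (fun c => c0_max c isT) x y K0 ec.
rewrite (con_free_edges _ j); last by move=> c; apply: c0_max.
by apply: con_mono; apply: subsetIl.
Qed.

End Packing.

(** * Even edge sets and closed trails *)

Section Parity.
Variables (V E : finType) (ends : E -> V * V).
Local Notation walk := (walk ends).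
Local Notation joins := (joins ends).
Local Notation con := (con ends).
Implicit Types (A B D J : {set E}) (x y z w v : V) (es : seq E).

(** The exclusive or makes a loop count 0, its contribution to the degree modulo 2. *)
Definition incident e x := (x == (ends e).1) (+) (x == (ends e).2).
Definition odd_deg A x := \big[addb/false]_(e in A) incident e x.

Lemma joins_incident e x y z : joins e x y -> incident e z = (z == x) (+) (z == y).
Proof. by rewrite /incident => /joinsP[] [-> ->] //; rewrite addbC. Qed.

Lemma odd_degE A x : odd_deg A x = \big[addb/false]_e ((e \in A) && incident e x).
Proof. by rewrite /odd_deg big_mkcond; apply: eq_bigr => e _; case: ifP. Qed.

Lemma odd_deg_trail x y es z : walk x y es -> uniq es ->
  odd_deg [set e in es] z = (z == x) (+) (z == y).
Proof.
move=> wes ues.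
have -> : odd_deg [set e in es] z = \big[addb/false]_(e <- es) incident e z.
  by rewrite /odd_deg [RHS]big_uniq //; apply: eq_bigl => e; rewrite inE.
elim: es x wes {ues} => [|e es IHes] x /=; first by move=> ->; rewrite big_nil addbb.
case=> u [j /IHes IH]; rewrite big_cons IH (joins_incident _ j).
by case: (z == x); case: (z == u); case: (z == y).
Qed.

Definition symdiff A B := [set e | (e \in A) (+) (e \in B)].

Lemma odd_deg_symdiff A B x : odd_deg (symdiff A B) x = odd_deg A x (+) odd_deg B x.
Proof.
rewrite !odd_degE -big_split; apply: eq_bigr => e _ /=.
by rewrite inE -andb_addl.
Qed.

Lemma odd_deg_setU A B x : [disjoint A & B] -> odd_deg (A :|: B) x = odd_deg A x (+) odd_deg B x.
Proof.
move=> dAB; rewrite -odd_deg_symdiff; congr odd_deg; apply/setP => e; rewrite !inE.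
by case: (boolP (e \in A)) => // /(disjointFr dAB) ->.
Qed.

Lemma odd_deg_setD A B x : B \subset A -> odd_deg (A :\: B) x = odd_deg A x (+) odd_deg B x.
Proof.
move=> /subsetP sBA; rewrite -odd_deg_symdiff; congr odd_deg; apply/setP => e; rewrite !inE.
by case: (boolP (e \in B)) => [/sBA ->|_] //; rewrite addbF.
Qed.

Lemma big_addb_mem (S : {set V}) x : \big[addb/false]_(z in S) (z == x) = (x \in S).
Proof.
rewrite big_mkcond (bigD1 x) //= eqxx big1 ?addbF; first by case: ifP.
by move=> z /negPf ->; case: ifP.
Qed.

(** Edges with both ends in [S] cancel. For [S] the whole vertex set this is the handshake lemma. *)
Lemma odd_deg_cut A (S : {set V}) :
  \big[addb/false]_(z in S) odd_deg A z = \big[addb/false]_(e in A) (e \in cut ends S).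
Proof.
rewrite /odd_deg exchange_big; apply: eq_bigr => e _.
by rewrite big_split /= !big_addb_mem inE.
Qed.

Lemma odd_deg_all_but D v : (forall x, x != v -> ~~ odd_deg D x) -> forall x, ~~ odd_deg D x.
Proof.
move=> ev x; have [->|] := eqVneq x v; last exact: ev.
have := odd_deg_cut D setT; rewrite (bigD1 v) ?inE //= big1; last first.
  by move=> z /andP[_ /ev/negPf].
by rewrite addbF => ->; rewrite big1 // => e _; rewrite !inE.
Qed.

(** Otherwise one side of the bridge [e] would have an even degree sum but exactly one leaving
    edge. *)
Lemma even_no_bridge D e : (forall x, ~~ odd_deg D x) -> e \in D ->
  con (D :\ e) (ends e).2 (ends e).1.
Proof.
move=> ev eD; apply/negPn/negP => nc.
have := odd_deg_cut D (component ends (D :\ e) (ends e).2).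
rewrite big1 => [|z _]; last by rewrite (negPf (ev z)).
rewrite (bigD1 e) //= !inE (negPf nc) con_refl big1 // => f /andP[fD nfe].
rewrite !inE; set c1 := con _ _ _; set c2 := con _ _ _.
suff -> : c1 = c2 by rewrite addbb.
have c12 : con (D :\ e) (ends f).1 (ends f).2.
  by apply: con1 (joins_ends _ _); rewrite !inE nfe.
by apply/idP/idP => h; apply: con_trans h _; rewrite // con_sym.
Qed.

(** [J] is a T-join: the symmetric difference of trails from the members of [s] to [v], which
    absorbs the leftover parity. *)
Lemma join_exists B v (s : seq V) : (forall x, con B x v) ->
  exists2 J : {set E}, J \subset B & forall x, x != v -> odd_deg J x = odd (count_mem x s).
Proof.
move=> cB; elim: s => [|u s [J sJB parJ]].
  by exists set0; rewrite ?sub0set // => x _; rewrite /odd_deg big_set0.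
have [es [wes ues esB]] := con_trail (cB u).
exists (symdiff J [set e in es]).
  apply/subsetP => e; rewrite !inE; have [/(subsetP sJB)//|_ /=] := boolP (e \in J).
  exact: esB.
move=> x xv; rewrite odd_deg_symdiff parJ // (odd_deg_trail _ wes ues) (negPf xv) addbF.
by rewrite /= oddD oddb addbC eq_sym.
Qed.

(** A T-join in [B] for the odd vertices of [A] repairs all degrees except perhaps at [v], which the
    handshake lemma settles. *)
Lemma even_connected_union A B v : [disjoint A & B] -> (forall x, con B x v) ->
  exists D : {set E}, [/\ A \subset D, D \subset A :|: B & forall x, ~~ odd_deg D x].
Proof.
move=> dAB cB.
have [J JB parJ] := join_exists (enum [set x | odd_deg A x]) cB.
exists (A :|: J); split; first exact: subsetUl.
  exact: setUS.
apply: (odd_deg_all_but (v := v)) => x xv.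
rewrite odd_deg_setU; last exact: disjointWr JB dAB.
by rewrite parJ // count_uniq_mem ?enum_uniq // mem_enum inE oddb addbb.
Qed.

Lemma closed_trail_insert w es x e y q : closed_trail ends w es -> visits ends w es x ->
  joins e x y -> walk y x q -> uniq q -> e \notin q -> e \notin es -> {in q, forall f, f \notin es} ->
  exists es', [/\ closed_trail ends w es', size es < size es' & es' =i es ++ e :: q].
Proof.
move=> [wes ues] /(visits_split wes)[a [b [ees wa wb]]] j wq uq eq ee qe.
have pe : perm_eq (a ++ (e :: q) ++ b) (es ++ e :: q).
  by rewrite ees -catA perm_cat2l perm_catC.
exists (a ++ (e :: q) ++ b); split.
- split.
    apply/walk_cat; exists x => //; apply/walk_cat; exists x => //.
    by exists y.
  rewrite (perm_uniq pe) cat_uniq ues /= eq uq negb_or ee /=.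
  by rewrite andbT; apply/hasPn => f /qe.
- by rewrite (perm_size pe) size_cat /= -addSnnS leq_addr.
- exact: perm_mem.
Qed.

(** While a vertex is unvisited, some edge [e] of [D] leaves the visited set. [D] minus the trail is
    still even, so [e] lies on a cycle there, which is spliced into the trail. *)
Lemma euler D w : (forall x, ~~ odd_deg D x) -> (forall x, con D w x) ->
  exists es, [/\ closed_trail ends w es, {subset es <= D} & forall x, visits ends w es x].
Proof.
move=> ev cD.
suff H es : closed_trail ends w es -> {subset es <= D} ->
    exists es, [/\ closed_trail ends w es, {subset es <= D} & forall x, visits ends w es x].
  exact: (H [::]).
have [n] := ubnP (#|D| - size es); elim: n es => // n IHn es lt_n cl sD.
have [/forallP all_vis|/forallPn[y0 nvis]] := boolP [forall x, visits ends w es x].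
  by exists es.
have vw : visits ends w es w by rewrite /visits eqxx.
have [e [x [y [eD j vx vy]]]] := con_crossing (cD y0) vw nvis.
have ee : e \notin es.
  by apply: contra vy => ee; apply/orP; right; have [] := meets_joins ee j.
pose D' := D :\: [set f in es].
have eD' : e \in D' by rewrite !inE ee.
have evD' z : ~~ odd_deg D' z.
  rewrite odd_deg_setD; last by apply/subsetP => f; rewrite inE => /sD.
  by rewrite (odd_deg_trail _ cl.1 cl.2) addbb addbF.
have : con (D' :\ e) y x.
  by rewrite con_sym -(con_endsE _ j) con_sym; apply: even_no_bridge.
case/con_trail=> q [wq uq sq].
have sq' f : f \in q -> [/\ f != e, f \notin es & f \in D].
  by move=> /sq; rewrite !inE => /and3P[].
have eq : e \notin q by apply/negP => /sq' []; rewrite eqxx.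
have qe : {in q, forall f, f \notin es} by move=> f /sq' [].
have [es' [cl' lt mem']] := closed_trail_insert cl vx j wq uq eq ee qe.
have sD' : {subset es' <= D}.
  by move=> f; rewrite mem' mem_cat inE => /or3P[/sD|/eqP ->|/sq' []].
have le : size es' <= #|D|.
  by rewrite -(card_uniqP cl'.2); apply/subset_leq_card/subsetP.
by apply: IHn cl' sD'; lia.
Qed.

End Parity.

(** * Long closed trails in 2-edge-connected graphs *)

Section TwoEdgeConnected.
Variables (V E : finType) (ends : E -> V * V).
Hypothesis ends_loopless : loopless ends.
Hypothesis ends_2ec : edge_connected ends 2.
Local Notation walk := (walk ends).
Local Notation joins := (joins ends).
Local Notation con := (con ends).
Local Notation adj := (adj ends).
Local Notation visits := (visits ends).
Local Notation closed_trail := (closed_trail ends).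
Implicit Types (A B D : {set E}) (x y z w v : V) (es : seq E).

Lemma joins_neq e x y : joins e x y -> x != y.
Proof. by move=> /joinsP j; have := ends_loopless e; case: j => [] [-> ->] //; rewrite eq_sym. Qed.

Lemma con_without e x y : con [set~ e] x y.
Proof. by apply: edge_connected_con ends_2ec _; rewrite cards1. Qed.

Lemma visitsP w es e x y : e \in es -> joins e x y -> visits w es x /\ visits w es y.
Proof. by move=> ees /(meets_joins ees)[mx my]; rewrite /visits mx my !orbT. Qed.

Lemma unvisited_notin w es e x y : ~~ visits w es x -> joins e x y -> e \notin es.
Proof. by move=> nv j; apply: contra nv => ees; case: (visitsP w ees j). Qed.

Definition neighbours v := [set y | adj setT v y].
Definition vertices w es := [set x | visits w es x].

(** * Closed trails through a vertex with many neighbours *)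

Section HighDegree.
Variables (v : V) (es : seq E).
Hypothesis cl : closed_trail v es.

(* [A] avoids the trail and the edges at [v]; a walk in [A] between the far
   ends of two unused edges at [v] closes up to a trail disjoint from [es]. *)
Let A := [set e | (e \notin es) && ~~ incident ends e v].

Lemma detour e1 e2 y z : joins e1 v y -> joins e2 v z -> e1 \notin es -> e2 \notin es ->
  e1 != e2 -> con A y z -> exists2 es', closed_trail v es' & size es < size es'.
Proof.
move=> j1 j2 e1s e2s e12 /con_trail[q [wq uq qA]].
have qA' f : f \in q -> [/\ f != e1, f != e2 & f \notin es].
  move=> /qA; rewrite inE => /andP[fs fv]; split=> //; apply: contraNneq fv => ->.
    by rewrite (joins_incident _ j1) eqxx (negPf (joins_neq j1)).
  by rewrite (joins_incident _ j2) eqxx (negPf (joins_neq j2)).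
have wq' : walk y v (rcons q e2).
  by rewrite -cats1; apply/walk_cat; exists z => //; apply: walk1; rewrite joinsC.
have vv : visits v es v by rewrite /visits eqxx.
have uq' : uniq (rcons q e2).
  by rewrite rcons_uniq uq andbT; apply/negP => /qA' []; rewrite eqxx.
have e1q : e1 \notin rcons q e2.
  by rewrite mem_rcons inE (negPf e12) /=; apply/negP => /qA' []; rewrite eqxx.
have [f|es' [cl' lt _]] := closed_trail_insert cl vv j1 wq' uq' e1q e1s.
  by rewrite mem_rcons inE => /predU1P[->|/qA'[]].
by exists es'.
Qed.

Lemma con_not_center y : y != v -> ~~ con A y v.
Proof.
move=> yv; apply/negP => c; have vv : ~~ predC1 v v by rewrite /= eqxx.
have [e [x [z [eA j xv]]]] := con_crossing c (yv : predC1 v y) vv.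
rewrite /= negbK => /eqP zv; move: eA; rewrite inE (joins_incident _ j) zv eqxx.
by rewrite eq_sym (negPf (xv : x != v)) andbF.
Qed.

(** Without [e1], some edge [e2] outside [A] still leaves the [A]-component of [y]. Its inner end
    [u] is visited, or else [e2] leads to [v] and a detour closes up. *)
Lemma ear_end y : y \in neighbours v -> ~~ visits v es y ->
  (exists w, [/\ con A y w, visits v es w & w != v]) \/
  (exists2 es', closed_trail v es' & size es < size es').
Proof.
rewrite inE => /existsP[e1 /andP[_ j1]] nvy.
have yv : y != v by rewrite eq_sym (joins_neq j1).
have [e2 [u [u' [e2e j2 cu cu']]]] :=
  con_crossing (con_without e1 y v) (con_refl ends A y : con A y y) (con_not_center yv).
have uv : u != v by apply: contraTneq cu => ->; apply: con_not_center.
have [vu|nvu] := boolP (visits v es u); first by left; exists u.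
right; have e2s : e2 \notin es by apply: unvisited_notin nvu j2.
have u'v : u' = v.
  apply/eqP; apply: contraNT cu' => u'v; apply: con_trans cu (con1 _ j2).
  by rewrite inE e2s (joins_incident _ j2) ![v == _]eq_sym (negPf uv) (negPf u'v).
have e1s : e1 \notin es by apply: (unvisited_notin nvy); rewrite joinsC; apply: j1.
apply: (detour j1 _ e1s e2s _ cu); first by rewrite joinsC -u'v.
by move: e2e; rewrite !inE eq_sym.
Qed.

(** If no detour exists, unvisited neighbours lie in distinct [A]-components, each containing a
    visited vertex; so they are at most as many as the visited vertices. *)
Lemma extend_or_many n : n <= #|vertices v es| \/ #|neighbours v| < 2 * n \/
  exists2 es', closed_trail v es' & size es < size es'.
Proof.
have [le|lt] := leqP n #|vertices v es|; [by left|right].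
pose N := neighbours v :\: vertices v es.
have cN : #|neighbours v| <= #|vertices v es| + #|N|.
  by rewrite -(cardsID (vertices v es)) leq_add2r; apply/subset_leq_card/subsetIr.
have mN y : y \in N -> y \in neighbours v /\ ~~ visits v es y by case/setDP; rewrite ![_ \in vertices _ _]inE.
have [/existsP[y1 /andP[y1N /existsP[y2 /and3P[y2N y12 c12]]]]|sep] :=
  boolP [exists y1 in N, exists y2, [&& y2 \in N, y1 != y2 & con A y1 y2]].
  right; have [] := mN _ y1N; have [] := mN _ y2N.
  rewrite !inE => /existsP[e2 /andP[_ j2]] nv2 /existsP[e1 /andP[_ j1]] nv1.
  apply: (detour j1 j2 _ _ _ c12).
  - by apply: (unvisited_notin nv1); rewrite joinsC; apply: j1.
  - by apply: (unvisited_notin nv2); rewrite joinsC; apply: j2.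
  - by apply: contraNneq y12 => e12; rewrite e12 in j1; rewrite (joins_fun j1 j2).
have [/forallP all_end|/forallPn[y]] := boolP [forall y,
    (y \in N) ==> [exists w, [&& con A y w, visits v es w & w != v]]]; last first.
  rewrite negb_imply => /andP[/mN[yN nvy] nex]; right.
  have [[w [c vw wv]]|//] := ear_end yN nvy.
  by case/existsP: nex; exists w; rewrite c vw.
left; pose f y := odflt y [pick w | [&& con A y w, visits v es w & w != v]].
have fP y : y \in N -> [/\ con A y (f y), visits v es (f y) & f y != v].
  move=> yN; have /implyP/(_ yN)/existsP[w0 w0P] := all_end y.
  by rewrite /f; case: pickP => [w /and3P[]|/(_ w0)] //; rewrite w0P.
have leN : #|N| <= #|vertices v es|.
  rewrite -(card_in_imset (f := f)).
    by apply/subset_leq_card/subsetP => _ /imsetP[y /fP[_ h _] ->]; rewrite inE.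
  move=> y1 y2 y1N y2N ef; apply/eqP; apply: contraNT sep => y12.
  apply/existsP; exists y1; rewrite y1N; apply/existsP; exists y2; rewrite y2N y12 /=.
  have [c1 _ _] := fP _ y1N; have [c2 _ _] := fP _ y2N.
  by apply: con_trans c1 _; rewrite ef con_sym.
by lia.
Qed.

End HighDegree.

Lemma high_degree_trail n v : 2 * n <= #|neighbours v| ->
  exists es, closed_trail v es /\ n <= #|vertices v es|.
Proof.
move=> deg; suff H es : closed_trail v es ->
    exists es, closed_trail v es /\ n <= #|vertices v es| by apply: (H [::]).
have [m] := ubnP (#|E| - size es); elim: m es => // m IHm es lt_m cl.
have [?|[|[es' cl' lt]]] := extend_or_many cl n; [by exists es|lia|].
apply: IHm (cl').
have : size es' <= #|E| by rewrite -(card_uniqP cl'.2); apply: max_card.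
lia.
Qed.

(* Ear step: an edge [yz] leaving the trail returns to it at some [w]; since
   [x] lies on one of the two arcs between [y] and [w], the other arc can be
   replaced by the ear. *)
Lemma common_trail_step x y z e es : closed_trail x es -> visits x es y -> joins e y z ->
  exists es', closed_trail x es' /\ visits x es' z.
Proof.
move=> cl vy j.
have [vz|nvz] := boolP (visits x es z); first by exists es.
have es_e : e \notin es by apply: (unvisited_notin nvz); rewrite joinsC; apply: j.
pose A := ~: [set f in e :: es].
(* If [z] does not reach [x] in [A], an edge other than [e] leaves its [A]-component; that edge is
   on the trail, so its inner end is visited. *)
have [w cw vw] : exists2 w, con A z w & visits x es w.
  have [czx|nczx] := boolP (con A z x); first by exists x; rewrite // /visits eqxx.
  have [f [u [u' [fe jf cu cu']]]] :=
    con_crossing (con_without e z x) (con_refl ends A z : con A z z) nczx.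
  exists u => //; suff fs : f \in es by have [] := visitsP x fs jf.
  apply: contraNT cu' => fs; apply: con_trans cu (con1 _ jf).
  by move: fe; rewrite !inE => /negPf ->.
have [q [wq uq qA]] := con_trail cw.
have qA' f : f \in q -> (f != e) * (f \notin es).
  by move=> /qA; rewrite !inE => /norP[].
case: cl => wes ues; have [a [b [ees wa wb]]] := visits_split wes vy.
have eq : e \notin q by apply/negP => /qA' []; rewrite eqxx.
have qs : ~~ has (mem es) q by apply/hasPn => f /qA' [].
have uniq_part s : uniq s -> {subset s <= es} -> uniq (s ++ e :: q).
  move=> us ss; rewrite cat_uniq us /= eq uq negb_or !andbT.
  apply/andP; split; first by apply: contra es_e; apply: ss.
  by apply: contra qs => /hasP[f fq fs]; apply/hasP; exists f; rewrite //=; apply: ss.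
have ueq : walk y w (e :: q) by exists z.
have zeq b' c : e \in b' -> visits c b' z.
  by move=> eb; case: (visitsP c eb j).
move: vw ues; rewrite ees (visits_cat _ _ wa) => /orP[vw|vw].
  have [a1 [a2 [ea w1 w2]]] := visits_split wa vw.
  rewrite ea -catA => ues.
  exists (a1 ++ (rev (e :: q)) ++ b); split; last first.
    by apply: zeq; rewrite !mem_cat mem_rev mem_head !orbT.
  split.
    apply/walk_cat; exists w => //; apply/walk_cat; exists y => //.
    exact: walk_rev.
  rewrite (perm_uniq (_ : perm_eq _ ((a1 ++ b) ++ e :: q))).
    apply: uniq_part.
      by move: ues; apply: subseq_uniq; apply: cat_subseq => //; apply: suffix_subseq.
    by move=> f; rewrite ees ea !mem_cat => /orP[] ->; rewrite ?orbT.
  by rewrite -catA perm_cat2l perm_catC perm_cat2l perm_rev.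
have [b1 [b2 [eb w1 w2]]] := visits_split wb vw.
rewrite eb => ues.
exists (a ++ (e :: q) ++ b2); split; last first.
  by apply: zeq; rewrite !mem_cat mem_head !orbT.
split.
  by apply/walk_cat; exists y => //; apply/walk_cat; exists w.
rewrite (perm_uniq (_ : perm_eq _ ((a ++ b2) ++ e :: q))).
  apply: uniq_part.
    by move: ues; apply: subseq_uniq; apply: cat_subseq => //; apply: suffix_subseq.
  by move=> f; rewrite ees eb !mem_cat => /orP[] ->; rewrite ?orbT.
by rewrite -catA perm_cat2l perm_catC.
Qed.

Lemma common_trail x y : exists es, closed_trail x es /\ visits x es y.
Proof.
have : con setT x y by rewrite -setC0; apply: edge_connected_con ends_2ec _; rewrite cards0.
case/con_trail=> q [wq _ _]; elim/last_ind: q y wq => [|q e IHq] y.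
  by move=> <-; exists [::]; rewrite /visits eqxx.
rewrite -cats1 => /walk_cat[u /IHq[es [cl vu]] [y0 [j y0y]]].
by rewrite -y0y; apply: common_trail_step cl vu j.
Qed.

(** * Balls, and long trails between distant vertices *)

Fixpoint ball x d : {set V} :=
  if d is d'.+1 then ball x d' :|: \bigcup_(u in ball x d') neighbours u else [set x].

Lemma card_ball k x d : (forall u, #|neighbours u| < k) -> #|ball x d| <= k ^ d.
Proof.
move=> bd; elim: d => [|d IHd] /=; first by rewrite cards1.
apply: leq_trans (leq_card_setU _ _) _; rewrite expnS.
apply: leq_trans (_ : #|ball x d| * k <= _); last by rewrite mulnC leq_mul2l IHd orbT.
have k0 : 0 < k by apply: leq_ltn_trans (bd x).
rewrite -[X in _ * X](prednK k0) mulnS leq_add2l -sum_nat_const.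
apply: (big_ind2 (fun (X : {set V}) m => #|X| <= m)) => [|X m Y p leX leY|u _].
- by rewrite cards0.
- exact: leq_trans (leq_card_setU _ _) (leq_add leX leY).
- by rewrite -ltnS prednK.
Qed.

(** A path leaving the ball meets every sphere of radius at most [d] about [x], each time in [W]. *)
Lemma far_vertices A (W : {set V}) x y d : con A x y -> x \in W -> y \notin ball x d ->
  (forall e u v, e \in A -> joins e u v -> v \in W) -> d < #|W :&: ball x d|.
Proof.
move=> cxy xW yd AW; elim: d yd => [|d IHd] /=.
  by move=> _; apply/card_gt0P; exists x; rewrite !inE xW eqxx.
rewrite in_setU => /norP[yd _]; apply: leq_ltn_trans (IHd yd) _.
have xd : x \in ball x d by elim: (d) => [|d' IH] /=; rewrite inE ?IH.
have [e [u [u' [eA j ud u'd]]]] := con_crossing cxy (xd : mem (ball x d) x) yd.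
apply/proper_card/properP; split; first exact/setIS/subsetUl.
exists u'; rewrite !inE (AW _ _ _ eA j) /= ?(negPf (u'd : u' \notin _)) //.
by apply/bigcupP; exists u; rewrite // inE; apply/existsP; exists e; rewrite inE.
Qed.

Lemma long_closed_trail n : (2 * n) ^ n < #|V| ->
  exists w es, closed_trail w es /\ n <= #|vertices w es|.
Proof.
move=> big; have [/existsP[v dv]|] := boolP [exists v, 2 * n <= #|neighbours v|].
  by exists v; apply: high_degree_trail.
rewrite negb_exists => /forallP small.
have [x _] : exists x : V, x \in V by apply/card_gt0P; apply: leq_ltn_trans big.
(* With fewer than [2 * n] neighbours everywhere, a ball of radius [n] has at most [(2 * n) ^ n]
   vertices. *)
have [y yb] : exists y, y \notin ball x n.
  apply/existsP; rewrite -negb_forall; apply/negP => /forallP all_in.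
  have : #|V| <= #|ball x n| by apply/subset_leq_card/subsetP => y _; apply: all_in.
  by apply/negP; rewrite -ltnNge; apply: leq_ltn_trans big; apply: card_ball => u; rewrite ltnNge.
have [es [cl vy]] := common_trail x y; exists x, es; split=> //.
have [a [b [ees wa wb]]] := visits_split cl.1 vy.
have c : con [set e in es] x y.
  by apply: walk_con wa _ => e ea; rewrite inE ees mem_cat ea.
have xW : x \in vertices x es by rewrite inE /visits eqxx.
have AW e u v : e \in [set e in es] -> joins e u v -> v \in vertices x es.
  by rewrite !inE => eb j; case: (visitsP x eb j).
apply: leq_trans (ltnW (far_vertices c xW yb AW)) _.
exact/subset_leq_card/subsetIl.
Qed.

End TwoEdgeConnected.

(** * Common monotone subsequences *)

Definition monotone (T : Type) (p : T -> nat) (s : seq T) :=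
  sorted (relpre p leq) s \/ sorted (relpre p geq) s.

Lemma geq_trans : transitive geq.
Proof. by move=> y x z /= yx zy; apply: leq_trans zy yx. Qed.

Lemma relpre_trans (T U : Type) (f : T -> U) (e : rel U) : transitive e -> transitive (relpre f e).
Proof. by move=> tr y x z; apply: tr. Qed.

(** Ramsey-style induction: compare the head [x] with the tail, recurse into the larger part and
    prepend [x] if it helps. This gives an exponential bound. *)
Lemma erdos_szekeres (T : eqType) (p : T -> nat) a b (s : seq T) : 2 ^ (a + b) <= size s ->
  (exists s', [/\ subseq s' s, size s' = a & sorted (relpre p leq) s']) \/
  (exists s', [/\ subseq s' s, size s' = b & sorted (relpre p geq) s']).
Proof.
have [n] := ubnP (a + b); elim: n a b s => // n IHn [|a] [|b] s lt_n.
- by left; exists [::]; rewrite sub0seq.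
- by left; exists [::]; rewrite sub0seq.
- by right; exists [::]; rewrite sub0seq.
case: s => [|x s] le_s; first by move: le_s; rewrite leqn0 expn_eq0.
have sub q s' : subseq s' (filter q s) -> subseq s' s.
  by move/subseq_trans; apply; apply: filter_subseq.
have cons_sub s' : subseq s' s -> subseq s' (x :: s).
  by move/subseq_trans; apply; apply: subseq_cons.
have sizes : size (filter (fun y => p x <= p y) s) + size (filter (fun y => ~~ (p x <= p y)) s) = size s.
  by rewrite !size_filter count_predC.
(* The tail has at least [2 * 2 ^ (a + b).+1 - 1] entries, so one part has at least
   [2 ^ (a + b).+1]. *)
have [leG|leL] : 2 ^ (a + b.+1) <= size (filter (fun y => p x <= p y) s) \/
                 2 ^ (a.+1 + b) <= size (filter (fun y => ~~ (p x <= p y)) s).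
- by move: le_s; rewrite /= addSn addnS !expnS -sizes; lia.
- have [[s' [s's <- srt]]|[s' [s's <- srt]]] := IHn a b.+1 _ ltac:(lia) leG.
    left; exists (x :: s'); split=> //; first by rewrite /= eqxx; apply: sub s's.
    rewrite /= (path_sortedE (relpre_trans leq_trans)) srt andbT.
    by apply/allP => y /(mem_subseq s's); rewrite mem_filter => /andP[].
  by right; exists s'; split=> //; apply/cons_sub/(sub _ _ s's).
- have [[s' [s's <- srt]]|[s' [s's <- srt]]] := IHn a.+1 b _ ltac:(lia) leL.
    by left; exists s'; split=> //; apply/cons_sub/(sub _ _ s's).
  right; exists (x :: s'); split=> //; first by rewrite /= eqxx; apply: sub s's.
  rewrite /= (path_sortedE (relpre_trans geq_trans)) srt andbT.
  apply/allP => y /(mem_subseq s's); rewrite mem_filter -ltnNge => /andP[lt _].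
  exact: ltnW.
Qed.

Lemma monotone_subseq (T : eqType) (p : T -> nat) s s' :
  subseq s' s -> monotone p s -> monotone p s'.
Proof.
by move=> sub [] srt; [left|right]; apply: subseq_sorted sub srt; apply: relpre_trans;
  [apply: leq_trans|apply: geq_trans].
Qed.

(** Each further function costs one application of [erdos_szekeres], replacing [g] by
    [2 ^ (g + g)]. *)
Lemma common_monotone_subseq t r : exists g, forall (T : eqType) (p : nat -> T -> nat) (s : seq T),
  g <= size s -> exists s', [/\ subseq s' s, size s' = r & forall j, j < t -> monotone (p j) s'].
Proof.
elim: t => [|t [g IHg]].
  by exists r => T p s le_s; exists (take r s); rewrite take_subseq size_takel.
exists (2 ^ (g + g)) => T p s le_s.
have [s1 [sub1 size1 mono1]] : exists s1, [/\ subseq s1 s, size s1 = g & monotone (p t) s1].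
  by case: (erdos_szekeres (p t) le_s) => [] [s1 [? ? ?]]; exists s1; split=> //; [left|right].
have [|s2 [sub2 size2 mono2]] := IHg T p s1; first by rewrite size1.
exists s2; split=> //; first exact: subseq_trans sub2 sub1.
move=> j; rewrite ltnS leq_eqVlt => /predU1P[->|]; last exact: mono2.
exact: monotone_subseq mono1.
Qed.

Lemma uniq_flatten_map (S T : eqType) (P : S -> seq T) (s : seq S) : uniq s ->
  (forall x, x \in s -> uniq (P x)) ->
  (forall x y z, z \in P x -> z \in P y -> x = y) -> uniq (flatten (map P s)).
Proof.
move=> us uP dP; elim: s us uP => //= x s IHs /andP[xs us] uP.
rewrite cat_uniq uP ?mem_head // IHs // ?andbT => [|y ys]; last by rewrite uP // inE ys orbT.
apply/hasPn => z /flatten_mapP[y ys zy]; apply: contra xs => zx.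
by rewrite (dP _ _ _ zx zy).
Qed.

Lemma leq_index_drop (T : eqType) (s : seq T) x i : uniq s -> x \in drop i s -> i <= index x s.
Proof.
move=> us xs; rewrite leqNgt -in_take ?(mem_drop xs) //.
by move: us; rewrite -{1}(cat_take_drop i s) cat_uniq => /and3P[_ /hasPn/(_ x xs)].
Qed.

Lemma index_take_lt (T : eqType) (s : seq T) x i : x \in take i s -> index x s < i.
Proof. by move=> xs; rewrite -in_take // (mem_take xs). Qed.

(** * Cutting closed trails into segments *)

Section Segments.
Variables (V E : finType) (ends : E -> V * V).
Local Notation walk := (walk ends).

(** The segments immerse one copy of $C_{1,r}$ in the trail. *)
Definition segmented r (phi : 'I_r -> V) (es : seq E) (Q : 'I_r -> seq E) :=
  [/\ forall i, walk (phi i) (phi (ordS i)) (Q i), forall i, uniq (Q i),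
      forall i, {subset Q i <= es} & forall i j e, e \in Q i -> e \in Q j -> i = j].

(** A relation, since a trail may pass [x] several times. *)
Definition at_position w es x i := i <= size es /\ walk w x (take i es).

Lemma visits_position w es x : walk w w es -> visits ends w es x -> exists i, at_position w es x i.
Proof.
move=> wes /(visits_split wes)[a [b [-> wa _]]]; exists (size a).
by rewrite /at_position size_cat leq_addr take_size_cat.
Qed.

Lemma walk_between w es x y i j : at_position w es x i -> at_position w es y j -> i <= j ->
  walk x y (drop i (take j es)).
Proof.
move=> [_ wi] [_]; rewrite -{1}(cat_take_drop i (take j es)) => /walk_cat[z wz wzy] le.
by move: wz; rewrite take_takel // => /(walk_fun wi) ->.
Qed.

Lemma walk_from w es x i : walk w w es -> at_position w es x i -> walk x w (drop i es).
Proof.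
by rewrite -{1}(cat_take_drop i es) => /walk_cat[z wz wzw] [_ /(walk_fun wz) <-].
Qed.

Lemma segments_nondecreasing r (phi : 'I_r -> V) w es (p : 'I_r -> nat) :
  closed_trail ends w es -> (forall i, at_position w es (phi i) (p i)) ->
  (forall i j : 'I_r, i <= j -> p i <= p j) -> exists Q, segmented phi es Q.
Proof.
move=> [wes ues] pos mono.
(* The last segment wraps around through [w], the common start and end of [es]. *)
pose Q (i : 'I_r) := if i.+1 < r then drop (p i) (take (p (ordS i)) es)
                     else drop (p i) es ++ take (p (ordS i)) es.
have ordS_lt (i : 'I_r) : i.+1 < r -> ordS i = i.+1 :> nat by move=> lt; rewrite /= modn_small.
have ordS_last (i : 'I_r) : ~~ (i.+1 < r) -> ordS i = 0 :> nat.
  by rewrite -leqNgt => le; have lt := ltn_ord i; rewrite /= (_ : i.+1 = r) ?modnn //; lia.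
(* Edges of [es] are distinct, so disjointness of segments reduces to disjointness of index
   ranges. *)
have index_Q (i : 'I_r) e : e \in Q i ->
    if i.+1 < r then p i <= index e es < p (ordS i)
    else (p i <= index e es) || (index e es < p (ordS i)).
  rewrite /Q; case: ifP => _; last first.
    by rewrite mem_cat => /orP[/(leq_index_drop ues)->|/index_take_lt ->]; rewrite ?orbT.
  move=> ed; rewrite (index_take_lt (mem_drop ed)) andbT.
  have := leq_index_drop (take_uniq _ ues) ed.
  by rewrite -{2}(cat_take_drop (p (ordS i)) es) index_cat (mem_drop ed).
exists Q; split.
- move=> i; rewrite /Q; case: ifP => [lt|/negbT last_i].
    by apply: walk_between (pos _) (pos _) (mono _ _ _); rewrite ordS_lt.
  apply/walk_cat; exists w; first exact: walk_from.
  by case: (pos (ordS i)).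
- move=> i; rewrite /Q; case: ifP => [_|/negbT last_i]; first by rewrite drop_uniq ?take_uniq.
  rewrite cat_uniq drop_uniq ?take_uniq //= andbT; apply/hasPn => e et.
  apply/negP => /(leq_index_drop ues); apply/negP; rewrite -ltnNge.
  apply: leq_trans (index_take_lt et) (mono _ _ _).
  by rewrite ordS_last.
- move=> i e; rewrite /Q; case: ifP => _; first by move/mem_drop/mem_take.
  by rewrite mem_cat => /orP[/mem_drop|/mem_take].
suff lt_disj (i j : 'I_r) e : i < j -> e \in Q i -> e \in Q j -> False.
  move=> i j e ei ej; apply/val_inj; have [lt|lt|//] := ltngtP i j.
    by case: (lt_disj _ _ _ lt ei ej).
  by case: (lt_disj _ _ _ lt ej ei).
move=> lt /index_Q; have lt_i : i.+1 < r by apply: leq_ltn_trans lt (ltn_ord j).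
rewrite lt_i => /andP[le_i lt_iS].
have le_Sj : p (ordS i) <= p j by apply: mono; rewrite ordS_lt.
move=> /index_Q; case: ifP => [_|/negbT last_j]; first by lia.
have : p (ordS j) <= p i by apply: mono; rewrite ordS_last.
by lia.
Qed.

Lemma closed_trail_rev w es : closed_trail ends w es -> closed_trail ends w (rev es).
Proof. by case=> wes ues; split; [apply: walk_rev|rewrite rev_uniq]. Qed.

Lemma at_position_rev w es x i : walk w w es -> at_position w es x i ->
  at_position w (rev es) x (size es - i).
Proof.
move=> wes pos; have [le _] := pos; split; first by rewrite size_rev leq_subr.
by rewrite take_rev subKn //; apply/walk_rev/walk_from.
Qed.

(** Decreasing positions become increasing on the reversed trail. *)
Lemma segments_monotone r (phi : 'I_r -> V) w es (p : V -> nat) x0 s :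
  closed_trail ends w es -> size s = r -> (forall i : 'I_r, phi i = nth x0 s i) ->
  (forall x, x \in s -> at_position w es x (p x)) ->
  monotone p s -> exists Q, segmented phi es Q.
Proof.
move=> cl size_s phiE pos mono.
have pos_phi i : at_position w es (phi i) (p (phi i)).
  by apply: pos; rewrite phiE mem_nth // size_s.
have in_s (i : 'I_r) : (i : nat) \in [pred n | n < size s] by rewrite inE size_s.
case: mono => srt.
  apply: segments_nondecreasing cl pos_phi _ => i j ij; rewrite !phiE.
  exact: (sorted_leq_nth (relpre_trans leq_trans) (fun _ => leqnn _) x0 srt) ij.
have [|||Q [walkQ uQ subQ disjQ]] := @segments_nondecreasing r phi w (rev es) (fun i => size es - p (phi i)).
- exact: closed_trail_rev.
- by move=> i; apply: at_position_rev (cl.1) _.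
- move=> i j ij; apply: leq_sub2l; rewrite !phiE.
  exact: (sorted_leq_nth (relpre_trans geq_trans) (fun _ => leqnn _) x0 srt) ij.
by exists Q; split=> // i e /subQ; rewrite mem_rev.
Qed.

End Segments.

(** * From edge-disjoint closed trails to the immersion *)

Lemma immersion_of_trails t r : 0 < r -> exists g, forall (V E : finType) (ends : E -> V * V)
    (w : 'I_t -> V) (es : 'I_t -> seq E) (S : {set V}),
  (forall j, closed_trail ends (w j) (es j)) ->
  (forall j k e, e \in es j -> e \in es k -> j = k) ->
  (forall j x, x \in S -> visits ends (w j) (es j) x) ->
  g <= #|S| -> immersion (@C_ends t r) ends.
Proof.
move=> r0; have [g mono_g] := common_monotone_subseq t r; exists g => V E ends w es S cl disj vis leS.
have [p pP] : exists p : 'I_t -> V -> nat, forall j x, x \in S -> at_position ends (w j) (es j) x (p j x).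
  apply: (fin_all_exists (P := fun j (p : V -> nat) => forall x,
    x \in S -> at_position ends (w j) (es j) x (p x))) => j.
  apply: (fin_all_exists (P := fun x n => x \in S -> at_position ends (w j) (es j) x n)) => x.
  have [xS|_] := boolP (x \in S); last by exists 0.
  by have [n nP] := visits_position (cl j).1 (vis j x xS); exists n.
(* Extends [p] to all natural indices; the default 0 only occurs for [n >= t]. *)
pose p' n x := if insub n is Some j then p j x else 0.
have [|s [sub_s size_s mono]] := mono_g _ p' (enum S); first by rewrite -cardE.
have us : uniq s by apply: subseq_uniq sub_s (enum_uniq _).
have sS x : x \in s -> x \in S by move/(mem_subseq sub_s); rewrite mem_enum.
have [x0 _] : exists x0 : V, x0 \in s.
  by case: s size_s {sub_s mono us sS} => [rE|x0 s _]; [rewrite -rE in r0|exists x0; apply: mem_head].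
pose phi (i : 'I_r) := nth x0 s i.
have [Q QP] : exists Q : 'I_t -> 'I_r -> seq E, forall j, segmented ends phi (es j) (Q j).
  apply: (fin_all_exists (P := fun j Qj => segmented ends phi (es j) Qj)) => j.
  apply: (segments_monotone (p := p j) (cl j) size_s) => [i|x /sS|]; [by []|exact: pP|].
  by have := mono j (ltn_ord j); congr (monotone _ s); rewrite /p' valK.
exists phi; split.
  by move=> i j /eqP; rewrite nth_uniq ?size_s // => /eqP/val_inj.
exists (fun h => Q h.2 h.1); split=> [h|]; first by have [walkQ _ _ _] := QP h.2; apply: walkQ.
apply: uniq_flatten_map (enum_uniq _) _ _ => [h _|[i j] [i' j'] e /=].
  by have [_ uQ _ _] := QP h.2.
move=> ei ei'; have [_ _ subQ disjQ] := QP j; have [_ _ subQ' _] := QP j'.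
have jj' := disj _ _ _ (subQ _ _ ei) (subQ' _ _ ei'); rewrite -{}jj' in ei' *.
by rewrite (disjQ _ _ _ ei ei').
Qed.

(** The [2 * t] colours ['I_t * bool] call for connectivity [4 * t]. Class [(j, true)] makes the
    [j]-th even set spanning and connected; [(j, false)] corrects its parities. *)
Lemma disjoint_spanning_trails t (V E : finType) (ends : E -> V * V) (w : V) :
  0 < t -> edge_connected ends (4 * t) -> exists es : 'I_t -> seq E,
  [/\ forall j, closed_trail ends w (es j), forall j k e, e \in es j -> e \in es k -> j = k
    & forall j x, visits ends w (es j) x].
Proof.
move=> t0 ec; have cK : #|{: 'I_t * bool}| = 2 * t by rewrite card_prod card_ord card_bool mulnC.
have [||c conc] := @packing V E ends ('I_t * bool)%type; rewrite ?cK ?muln_gt0 //.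
  by rewrite mulnA.
have [es esP] : exists es : 'I_t -> seq E, forall j, [/\ closed_trail ends w (es j),
    forall e, e \in es j -> (c e).1 = j & forall x, visits ends w (es j) x].
  apply: (fin_all_exists (P := fun j (es : seq E) => [/\ closed_trail ends w es,
    forall e, e \in es -> (c e).1 = j & forall x, visits ends w es x])) => j.
  have disj : [disjoint cls c (j, true) & cls c (j, false)].
    by rewrite disjoints_subset; apply/subsetP => e; rewrite !inE => /eqP ->; rewrite xpair_eqE andbF.
  have [D [subD Dsub evD]] := even_connected_union disj (fun x => conc (j, false) x w).
  have conD x : con ends D w x by apply: con_mono subD _ _ (conc _ _ _).
  have [es [cl sD vis]] := euler evD conD; exists es; split=> // e /sD /(subsetP Dsub).
  by rewrite !inE => /orP[] /eqP ->.
exists es; split=> [j|j k e|j]; have [? ek ?] := esP j => //.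
by move/ek <-; have [_ ek' _] := esP k; move/ek'.
Qed.

Theorem theorem1p5 :
  forall t r : nat, 1 <= t -> 3 <= r ->
  exists f : nat,
    forall (V E : finType) (ends : E -> V * V),
      loopless ends ->
      edge_connected ends (6 * t - 4) ->
      f <= #|V| ->
      immersion (@C_ends t r) ends.
Proof.
move=> t r t1 r3; have [->|t2] : t = 1 \/ 2 <= t by lia.
  (* Here [6 * t - 4] is 2, as the section on long closed trails assumes. *)
  have [g imm] := immersion_of_trails 1 (ltnW (ltnW r3)).
  exists ((2 * g) ^ g).+1 => V E ends ll ec big.
  have [w [es [cl le]]] := long_closed_trail ll ec big.
  apply: (imm _ _ _ (fun=> w) (fun=> es) (vertices ends w es)) => //.
    by move=> j k; rewrite !ord1.
  by move=> _ x; rewrite inE.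
have [g imm] := immersion_of_trails t (ltnW (ltnW r3)).
(* The successor guarantees a vertex [w] even if [g] is 0. *)
exists g.+1 => V E ends _ ec big.
have [w _] : exists w : V, w \in V by apply/card_gt0P; apply: leq_trans big.
have ec' : edge_connected ends (4 * t) by move=> X lt; apply: ec; lia.
have [es [cl disj vis]] := disjoint_spanning_trails w t1 ec'.
apply: (imm _ _ _ (fun=> w) es setT) => [//|//|j x _|]; first exact: vis.
by rewrite cardsT ltnW.
Qed.
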